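(* There exist a zero-dimensional metrizable separable space $X\subseteq\mathbb R$ and an arcwise connected $G_\delta$-set $E\subseteq\mathbb R^2$ such that $E$ is homeomorphic to the perfect cone $\Delta_p(X)$ over $X$ and $E$ is not a $B_1$-retract of $\mathbb R^2$.
   Context: Perfect cone: for a topological space $X$, the cone $\Delta(X)$ is the quotient space $(X\times[0,1])/(X\times\{0\})$ with quotient mapping $\lambda:X\times[0,1]\to\Delta(X)$; its vertex is the point $v=\lambda(X\times\{0\})$. The perfect cone $\Delta_p(X)$ is the set $\Delta(X)$ equipped with the topology $\mathcal T_p$ which coincides with the quotient topology on $\lambda(X\times(0,1])\simeq X\times(0,1]$ (an open subset), and for which the sets $\lambda(X\times[0,\varepsilon))$, $\varepsilon>0$, form a base of neighborhoods of $v$. A subset $E$ of a topological space $Y$ is a $B_1$-retract of $Y$ if there exist a sequence of continuous mappings $r_n:Y\to E$ and a mapping $r:Y\to E$ such that $r_n(y)\to r(y)$ for all $y\in Y$ and $r(y)=y$ for all $y\in E$. *)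

(* Defs.v *)
From HB Require Import structures.
From mathcomp Require Import all_boot all_order all_algebra generic_quotient.
From mathcomp Require Import all_classical all_reals.
From mathcomp Require Import topology normedtype borel_hierarchy.

Set Implicit Arguments.
Unset Strict Implicit.
Unset Printing Implicit Defensive.

Import Order.TTheory GRing.Theory Num.Theory.
Import numFieldTopology.Exports.

Local Open Scope classical_set_scope.
Local Open Scope ring_scope.
Local Open Scope quotient_scope.

(* Throughout, a subset A of a space is regarded as a space of its own through
   [set_type A], which carries the topology induced by the inclusion. *)

Definition homeomorphism (S T : topologicalType) (f : S -> T) : Prop :=
  continuous f /\
  exists g : T -> S, [/\ continuous g, cancel f g & cancel g f].

Definition homeomorphic (S T : topologicalType) : Prop :=
  exists f : S -> T, homeomorphism f.

Definition metrizable (R : realType) (T : topologicalType) : Prop :=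
  exists M : metricType R, homeomorphic T M.

Definition separable (T : topologicalType) : Prop :=
  exists2 D : set T, countable D & dense D.

(* Small inductive dimension 0: nonempty, with a base of clopen sets. The
   library's [zero_dimensional] only asks that clopen sets separate points,
   which is weaker for general spaces. *)
Definition ind_zero (T : topologicalType) : Prop :=
  [set: T] !=set0 /\ basis (@clopen T).

Definition unit_itv (R : realType) : Type := set_type (`[0, 1]%classic : set R).

HB.instance Definition _ (R : realType) := Topological.on (unit_itv R).

Lemma unit_itv0_subproof (R : realType) :
  (0 : R) \in (`[0, 1]%classic : set R).
Proof. by rewrite inE/= in_itv/= lexx ler01. Qed.

Lemma unit_itv1_subproof (R : realType) :
  (1 : R) \in (`[0, 1]%classic : set R).
Proof. by rewrite inE/= in_itv/= lexx ler01. Qed.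

Definition unit_itv0 (R : realType) : unit_itv R :=
  exist _ 0 (unit_itv0_subproof R).
Definition unit_itv1 (R : realType) : unit_itv R :=
  exist _ 1 (unit_itv1_subproof R).

(* Any two distinct points are the endpoints of an arc, i.e. of a subset
   homeomorphic to [0, 1]. *)
Definition arcwise_connected (R : realType) (T : topologicalType) : Prop :=
  forall x y : T, x <> y ->
    exists (A : set T) (h : unit_itv R -> set_type A),
      [/\ homeomorphism h,
          set_val (h (unit_itv0 R)) = x &
          set_val (h (unit_itv1 R)) = y].

Section cone.
Context (R : realType) (T : topologicalType).

Let cyl : Type := (T * unit_itv R)%type.

Let cone_rel' (p q : cyl) : bool :=
  (p == q) || ((p.2 == unit_itv0 R) && (q.2 == unit_itv0 R)).

Local Lemma cone_rel_refl : reflexive cone_rel'.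
Proof. by move=> p; rewrite /cone_rel' eqxx. Qed.

Local Lemma cone_rel_sym : symmetric cone_rel'.
Proof. by move=> p q; rewrite /cone_rel' eq_sym andbC. Qed.

Local Lemma cone_rel_trans : transitive cone_rel'.
Proof.
move=> q p r /predU1P[-> //|] + /predU1P[<- //|]; rewrite /cone_rel'.
by move=> /andP[-> _] /andP[_ ->]; rewrite orbT.
Qed.

Definition cone_rel := EquivRel cone_rel' cone_rel_refl cone_rel_sym
  cone_rel_trans.

Definition cone : Type := {eq_quot cone_rel}.

HB.instance Definition _ := Quotient.on cone.
HB.instance Definition _ := Topological.copy cone (quotient_topology cone).

Definition cone_pi (p : T * unit_itv R) : cone := \pi_cone p.

(* The vertex, as a set: a singleton, unless T is empty. *)
Definition cone_vertex : set cone := cone_pi @` [set p | set_val p.2 = 0].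

Definition cone_bottom (e : R) : set cone :=
  cone_pi @` [set p | set_val p.2 < e].

Definition perfect_cone : Type := cone.

HB.instance Definition _ := Choice.on perfect_cone.

(* The topology which is the quotient topology away from the vertex and in
   which the sets [cone_bottom e], e > 0, form a base of neighborhoods of the
   vertex; see [perfect_cone_openE] and [perfect_cone_nbhs_vertex]. *)
Definition perfect_cone_open (U : set perfect_cone) : Prop :=
  open (U `\` cone_vertex : set cone) /\
  (U `&` cone_vertex !=set0 -> exists2 e : R, 0 < e & cone_bottom e `<=` U).

Lemma cone_pi_eq (p q : T * unit_itv R) :
  cone_pi p = cone_pi q -> p = q \/ set_val p.2 = 0 /\ set_val q.2 = 0.
Proof.
move=> pq; have /eqmodP : p = q %[mod {eq_quot cone_rel}] by [].
move=> /predU1P[->|]; first by left.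
by move=> /andP[/eqP -> /eqP ->]; right.
Qed.

Lemma cone_pi_vertex (p : T * unit_itv R) :
  cone_vertex (cone_pi p) <-> set_val p.2 = 0.
Proof.
by split=> [[q /= q0 /cone_pi_eq[<-//|[]]]//|p0]; exists p.
Qed.

Lemma cone_pi_bottom (p : T * unit_itv R) (e : R) : 0 < e ->
  cone_bottom e (cone_pi p) <-> set_val p.2 < e.
Proof.
move=> e0; split=> [[q /= qe /cone_pi_eq[<-//|[_ ->]]]//|pe]; by exists p.
Qed.

Lemma cone_openE (U : set cone) : open U = open (cone_pi @^-1` U).
Proof. by []. Qed.

Let unit_itv_val_continuous : continuous (set_val : unit_itv R -> R).
Proof. exact: initial_continuous. Qed.

Let height_continuous :
  continuous (fun p : T * unit_itv R => set_val p.2 : R).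
Proof.
move=> p; apply: (@continuous_comp _ _ _ snd (set_val : unit_itv R -> R)).
  exact: cvg_snd.
exact: unit_itv_val_continuous.
Qed.

Lemma cone_vertexC_open : open (~` cone_vertex).
Proof.
rewrite cone_openE.
have -> : cone_pi @^-1` (~` cone_vertex) =
    (fun p : T * unit_itv R => set_val p.2 : R) @^-1` (~` [set 0]).
  by apply/seteqP; split=> p /= np p0; apply: np; apply/cone_pi_vertex.
move/continuousP: height_continuous; apply.
exact/closed_openC/closed_eq.
Qed.

Lemma cone_bottom_open (e : R) : 0 < e -> open (cone_bottom e).
Proof.
move=> e0; rewrite cone_openE.
have -> : cone_pi @^-1` (cone_bottom e) =
    (fun p : T * unit_itv R => set_val p.2 : R) @^-1` [set x | x < e].
  by apply/seteqP; split=> p /= /(cone_pi_bottom _ e0).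
by move/continuousP: height_continuous; apply; exact: open_lt.
Qed.

Local Lemma perfect_cone_openT : perfect_cone_open setT.
Proof. by split=> [|_]; [rewrite setTD; exact: cone_vertexC_open|exists 1]. Qed.

Local Lemma perfect_cone_openI : setI_closed perfect_cone_open.
Proof.
move=> U V [oU vU] [oV vV]; split.
  have -> : (U `&` V) `\` cone_vertex =
      (U `\` cone_vertex) `&` (V `\` cone_vertex).
    by apply/seteqP; split=> x /=; tauto.
  exact: openI.
move=> [x [[Ux Vx] vx]].
have [|e e0 eU] := vU; first by exists x.
have [|d d0 dV] := vV; first by exists x.
exists (Num.min e d); first by rewrite lt_min e0.
move=> y [p /= + <-]; rewrite lt_min => /andP[pe pd].
by split; [apply: eU|apply: dV]; exists p.
Qed.

Local Lemma perfect_cone_open_bigU (I : Type) (f : I -> set perfect_cone) :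
  (forall i, perfect_cone_open (f i)) ->
  perfect_cone_open (\bigcup_i f i).
Proof.
move=> fo; split.
  have -> : (\bigcup_i f i) `\` cone_vertex = \bigcup_i (f i `\` cone_vertex).
    apply/seteqP; split=> x /=; first by move=> [[i _ fx] vx]; exists i.
    by move=> [i _ [fx vx]]; split => //; exists i.
  by apply: bigcup_open => i _; exact: (fo i).1.
move=> [x [[i _ fx] vx]].
have [|e e0 efi] := (fo i).2; first by exists x.
by exists e => // y /efi fy; exists i.
Qed.

HB.instance Definition _ := isOpenTopological.Build perfect_cone
  perfect_cone_openT perfect_cone_openI perfect_cone_open_bigU.

Lemma perfect_cone_openE (U : set perfect_cone) : U `<=` ~` cone_vertex ->
  open U <-> open (U : set cone).
Proof.
move=> Uv; have UE : U `\` cone_vertex = U.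
  by apply/seteqP; split=> x //=; [case|move=> Ux; split=> //; exact: Uv].
split=> [[]|oU]; first by rewrite UE.
by split=> [|[x [/Uv]]]//; rewrite UE.
Qed.

Lemma perfect_cone_nbhs_vertex (v : perfect_cone) (U : set perfect_cone) :
  cone_vertex v ->
  nbhs v U <-> exists2 e : R, 0 < e & cone_bottom e `<=` U.
Proof.
move=> vv; rewrite nbhsE; split.
  move=> [V [[_ Vv] Vx] VU]; have [|e e0 eV] := Vv; first by exists v.
  by exists e => //; exact: subset_trans VU.
move=> [e e0 eU]; exists (cone_bottom e) => //; split.
  split; last by exists e.
  by apply: openI; [exact: cone_bottom_open|exact: cone_vertexC_open].
by case: vv => p /= p0 <-; exists p => //=; rewrite p0.
Qed.

End cone.

Definition B1_retract (Y : topologicalType) (E : set Y) : Prop :=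
  exists (r_ : nat -> Y -> set_type E) (r : Y -> set_type E),
    [/\ forall n, continuous (r_ n),
        forall y, r_ n y @[n --> \oo] --> r y &
        forall y : set_type E, r (set_val y) = y].

(* Main.v *)
From HB Require Import structures.
Require Import Defs.
From mathcomp Require Import all_boot all_order all_algebra.
From mathcomp Require Import all_classical all_reals.
From mathcomp Require Import topology normedtype borel_hierarchy.
From mathcomp Require Import sequences.
From mathcomp Require Import ring lra.

Import Order.TTheory GRing.Theory Num.Theory.
Import numFieldTopology.Exports.
Import numFieldNormedType.Exports.

Local Open Scope classical_set_scope.
Local Open Scope ring_scope.

(** Take for [X] the irrational numbers of ]0, 1[ and for [E] the planar fan
    over [X]: the union of the segments joining the origin to the points
    (x, 1), for x in [X].

    Away from the origin a point (a, t) of the fan is determined by its slope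
    a / t, an element of [X], and its height t, both continuous; and as [X] is
    bounded, the points of small height form a base of neighborhoods of the
    origin.  This is exactly the perfect cone ([fan_homeomorphic]).  Two points
    of the fan are joined by a segment or by a broken line through the origin
    ([fan_arcwise_connected]), and since [X] is a G_delta set of slopes, so is
    the fan ([fan_Gdelta]).

    Suppose that continuous maps r_n from the plane to the fan converge
    pointwise to the identity on the fan.  The point is that a connected subset
    of the fan which avoids the origin lies in a single segment, the slopes
    being irrational.  For x in [X] the height of r_n(x, 1) tends to 1, so it is
    eventually above 1/2; by the Baire category theorem there are N and an open
    subinterval J of [0, 1] such that for all n >= N the height of r_n(x, 1) is
    at least 1/2 throughout J.  Choose irrationals c < d in J with a rational q
    between them.  For n large the slope of r_n(c, 1) is below q and that of
    r_n(d, 1) is above q, so some z between c and d makes r_n(z, 1) a point of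
    the fan of rational slope q and positive height, which is absurd
    ([fan_irrational_not_B1_retract]). *)

Set Implicit Arguments.
Unset Strict Implicit.
Unset Printing Implicit Defensive.

(** * Maps into and out of subspaces *)

Lemma cvg_set_type (T U : topologicalType) (A : set U) (f : T -> set_type A)
    (x : T) :
  set_val (f y) @[y --> x] --> set_val (f x) -> f y @[y --> x] --> f x.
Proof.
move=> cf V [_ [[W oW <-] /= Wl WV]].
by apply: filterS WV _; apply: cf; exact: open_nbhs_nbhs.
Qed.

Lemma set_val_continuous (U : topologicalType) (A : set U) :
  continuous (set_val : set_type A -> U).
Proof. exact: initial_continuous. Qed.

Definition set_elt (U : Type) (A : set U) (u : U) (Au : A u) : set_type A :=
  exist (fun v => v \in A) u (mem_set Au).

Lemma set_val_inj (U : Type) (A : set U) :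
  injective (set_val : set_type A -> U).
Proof. exact: val_inj. Qed.

Lemma continuous_at_pair (S T U : topologicalType) (f : S -> T) (g : S -> U)
    (x : S) :
  f y @[y --> x] --> f x -> g y @[y --> x] --> g x ->
  (f y, g y) @[y --> x] --> (f x, g x).
Proof. by move=> cf cg; exact: cvg_pair. Qed.

Lemma continuous_fst (S T : topologicalType) : continuous (@fst S T).
Proof. by move=> p; exact: cvg_fst. Qed.

Lemma continuous_snd (S T : topologicalType) : continuous (@snd S T).
Proof. by move=> p; exact: cvg_snd. Qed.

Lemma open_lt_fun (R : realType) (T : topologicalType) (f g : T -> R) :
  continuous f -> continuous g -> open [set x | f x < g x].
Proof.
move=> cf cg.
have -> : [set x | f x < g x] = (fun x => g x - f x) @^-1` [set y | 0 < y].
  by apply/seteqP; split=> x /=; rewrite subr_gt0.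
apply: open_comp; last exact: open_gt.
by move=> x _; apply: cvgB; [exact: cg|exact: cf].
Qed.

Lemma unit_itvP (R : realType) (t : unit_itv R) : 0 <= set_val t <= 1.
Proof. by have := set_valP t; rewrite /= in_itv. Qed.

(** A left inverse [L] defined on the whole ambient space spares a compactness
    argument: its restriction to the image of the path is the continuous
    inverse. *)
Lemma arc_of_left_inverse (R : realType) (T : topologicalType) (E : set T)
    (x y : set_type E) (g : R -> T) (L : T -> R) :
  continuous g -> continuous L ->
  (forall w, 0 <= w <= 1 -> E (g w)) ->
  (forall w, 0 <= w <= 1 -> L (g w) = w) ->
  g 0 = set_val x -> g 1 = set_val y ->
  exists (A : set (set_type E)) (h : unit_itv R -> set_type A),
    [/\ homeomorphism h,
        set_val (h (unit_itv0 R)) = x &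
        set_val (h (unit_itv1 R)) = y].
Proof.
move=> cg cL Eg Lg g0 g1.
pose h0 (w : unit_itv R) : set_type E := set_elt (Eg _ (unit_itvP w)).
pose A := range h0.
have Ah0 w : A (h0 w) by exists w.
pose h w : set_type A := set_elt (Ah0 w).
have inv_itv (a : set_type A) : [set` `[0, 1]] (L (set_val (set_val a))).
  have [w _ /= wa] := set_valP a; have w01 := unit_itvP w.
  by rewrite -[set_val a]wa /= Lg// in_itv.
pose k a : unit_itv R := set_elt (inv_itv a).
have hK : cancel h k.
  by move=> w; apply: val_inj => /=; rewrite Lg//; exact: unit_itvP.
have cLk : continuous (fun a : set_type A => L (set_val (set_val a))).
  move=> a; apply: (@continuous_comp _ _ _
    (fun a : set_type A => set_val (set_val a)) L); last exact: cL.
  apply: (@continuous_comp _ _ _ (set_val : set_type A -> set_type E)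
    (set_val : set_type E -> T)); exact: set_val_continuous.
exists A, h; split.
- split.
    move=> w; do 2 apply: cvg_set_type.
    apply: (@continuous_comp _ _ _ (set_val : unit_itv R -> R) g).
      exact: set_val_continuous.
    exact: cg.
  exists k; split=> //.
    by move=> a; apply: cvg_set_type; exact: cLk.
  move=> a; have [w _ wa] := set_valP a.
  have -> : a = h w by apply: val_inj.
  by rewrite hK.
- by apply: val_inj.
- by apply: val_inj.
Qed.

(** * Subspaces of the real line *)

Section subspaces_of_the_line.
Context (R : realType).
Implicit Type X : set R.

Lemma metrizable_set_type X : metrizable R (set_type X).
Proof.
pose dist (x y : set_type X) : R := `|set_val x - set_val y|.
have dist_ge0 x y : 0 <= dist x y by exact: normr_ge0.
have dist_eq0 x y : dist x y = 0 -> x = y.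
  by move=> /normr0_eq0/eqP; rewrite subr_eq0 => /eqP /val_inj.
have ballE x d : ball x d = [set y | dist x y < d] by [].
pose M : metricType R := HB.pack (set_type X)
  (PseudoMetric_isMetric.Build R (set_type X) dist_ge0 dist_eq0 ballE).
by exists M, id; split; [move=> x|exists id; split=> // x]; exact: cvg_id.
Qed.

(** The traces of the countably many intervals with rational endpoints form a
    base; this gives both separability and, when the rational endpoints are
    missing from the subspace, a base of clopen sets. *)
Lemma set_type_nbhs_itv X (x : set_type X) (U : set (set_type X)) :
  nbhs x U -> exists q : rat * rat,
    [/\ ratr q.1 < set_val x < ratr q.2 &
        forall y, ratr q.1 < set_val y < ratr q.2 -> U y].
Proof.
move=> [_ [[W oW <-] /= Wx WU]].
have /nbhs_ballP[e /= e0 eW] := open_nbhs_nbhs (conj oW Wx).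
have [|p] := @rat_in_itvoo R (set_val x - e) (set_val x).
  by rewrite ltrBlDr ltrDl.
have [|q] := @rat_in_itvoo R (set_val x) (set_val x + e).
  by rewrite ltrDl.
rewrite !in_itv/= => /andP[xq qe] /andP[ep px].
exists (p, q); split=> [/=|y /= /andP[py yq]]; first by rewrite px.
by apply/WU/eW; rewrite /ball/= ltr_distlC; apply/andP; split; lra.
Qed.

Lemma separable_set_type X : separable (set_type X).
Proof.
have [[x0 _]|X0] := pselect (exists x : set_type X, True); last first.
  by exists set0 => [|O [x]]//; case: X0; exists x.
pose itv (q : rat * rat) :=
  [set y : set_type X | ratr q.1 < set_val y < ratr q.2].
exists ((fun q => xget x0 (itv q)) @` setT).
  by apply: (card_le_trans (card_image_le _ _)); exact: countableP.
move=> O [x Ox] oO.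
have /set_type_nbhs_itv[q [qx qO]] := open_nbhs_nbhs (conj oO Ox).
exists (xget x0 (itv q)); split; last by exists q.
by apply: qO; case: xgetP => [y _ //|/(_ x)]; case.
Qed.

Lemma ind_zero_irrational X :
  X !=set0 -> X `<=` @irrational R -> ind_zero (set_type X).
Proof.
move=> [x0 Xx0] Xirr; split; first by exists (set_elt Xx0).
split=> [U []//|x U /set_type_nbhs_itv[q [qx qU]]].
exists [set y : set_type X | ratr q.1 < set_val y < ratr q.2]; last exact: qU.
have itvE : [set y : set_type X | ratr q.1 < set_val y < ratr q.2] =
    set_val @^-1` `]ratr q.1, ratr q.2[%classic.
  by apply/seteqP; split=> y /=; rewrite in_itv.
split=> //; split; rewrite itvE.
  by apply: open_comp => [y _|]; [exact: set_val_continuous|exact: itv_open].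
(* The endpoints are rational, hence not in X: the open and the closed
   interval have the same trace. *)
have -> : (set_val : set_type X -> R) @^-1` `]ratr q.1, ratr q.2[%classic =
    set_val @^-1` `[ratr q.1, ratr q.2]%classic.
  apply/seteqP; split=> y /=; rewrite !in_itv/=.
    by move=> /andP[/ltW -> /ltW ->].
  have yq p : ratr p != set_val y :> R.
    by apply/eqP => py; apply: (Xirr _ (set_valP y)); exists p.
  by rewrite !le_eqVlt (negbTE (yq _)) eq_sym (negbTE (yq _)).
by apply: closed_comp => [y _|]; [exact: set_val_continuous|exact: itv_closed].
Qed.

End subspaces_of_the_line.

(** By the Baire category theorem: the irrationals are the intersection of a
    sequence of dense open sets. *)
Lemma irrational_in_itvoo (R : realType) (a b : R) : a < b ->
  exists2 c, irrational c & a < c < b.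
Proof.
move=> ab; have [B oB irrB] := @irrational_Gdelta R.
have [||c [cab]] := Baire oB (O := `]a, b[%classic).
- by exists ((a + b) / 2); rewrite /= in_itv/=; apply/andP; split; lra.
- exact: itv_open.
by rewrite -irrB => ic; exists c => //; move: cab; rewrite /= in_itv.
Qed.

(** * The fan over a set of slopes *)

(** The union of the segments from the origin to the points (x, 1), x in [X]. *)
Definition fan (R : realType) (X : set R) : set (R * R) :=
  [set p | 0 <= p.2 <= 1 /\ exists2 x, X x & p.1 = x * p.2].

Lemma fan_polar (R : realType) (X : set R) (y : set_type (fan X)) :
  exists2 x, X x & exists2 t : R, 0 <= t <= 1 & set_val y = (x * t, t).
Proof.
case: y (set_valP y) => -[a t] yX [/= t01 [x Xx ax]].
by exists x => //; exists t => //; rewrite -ax.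
Qed.

Lemma fan_arcwise_connected (R : realType) (X : set R) :
  arcwise_connected R (set_type (fan X)).
Proof.
move=> y1 y2 y12.
have [x Xx [s h1 y1E]] := fan_polar y1; have [z Xz [t h2 y2E]] := fan_polar y2.
have affine_continuous a b : continuous (fun w : R => a + b * w).
  move=> w; apply: cvgD; first exact: cvg_cst.
  by apply: cvgM; [exact: cvg_cst|exact: cvg_id].
(* On a common segment, the height gives back the parameter. *)
have [xz|/eqP xz] := eqVneq x z.
  have st : t - s != 0.
    rewrite subr_eq0; apply/eqP => st; apply: y12; apply: set_val_inj.
    by rewrite y1E y2E xz st.
  pose u w := s + (t - s) * w.
  apply: (@arc_of_left_inverse _ _ _ _ _ (fun w => (x * u w, u w))
      (fun p => (t - s)^-1 * (p.2 - s))).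
  - move=> w; apply: continuous_at_pair; last exact: affine_continuous.
    by apply: cvgM; [exact: cvg_cst|exact: affine_continuous].
  - move=> p; apply: cvgM; first exact: cvg_cst.
    by apply: cvgB; [exact: cvg_snd|exact: cvg_cst].
  - move=> w w01; split; last by exists x.
    by rewrite /u /=; apply/andP; split; nra.
  - by move=> w _; rewrite /u /=; field.
  - by rewrite y1E /u mulr0 addr0.
  - by rewrite y2E /u mulr1 -xz addrC subrK.
have st : 0 < s + t.
  rewrite lt_def addr_ge0 ?andbT; [|lra|lra].
  apply/eqP => st; apply: y12; apply: set_val_inj; rewrite y1E y2E.
  have -> : s = 0 by lra.
  have -> : t = 0 by lra.
  by rewrite !mulr0.
(* Otherwise the path follows the segment of slope x down to the origin, then
   the segment of slope z up: u is the height, counted negatively on the first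
   segment.  The linear form with values -1 at (x, 1) and 1 at (z, 1) gives
   back u, and u gives back the parameter. *)
pose u w := - s + (s + t) * w.
have cu w : u w' @[w' --> w] --> u w by exact: affine_continuous.
apply: (@arc_of_left_inverse _ _ _ _ _
    (fun w => ((x + z) / 2 * `|u w| + (z - x) / 2 * u w, `|u w|))
    (fun p => (s + t)^-1 * ((z - x)^-1 * (2 * p.1 - (x + z) * p.2) + s))).
- move=> w; apply: continuous_at_pair; last exact: (cvg_norm (cu w)).
  by apply: cvgD; apply: cvgM;
    [exact: cvg_cst|exact: (cvg_norm (cu w))|exact: cvg_cst|exact: cu].
- move=> p; apply: cvgM; first exact: cvg_cst.
  apply: cvgD; last exact: cvg_cst.
  apply: cvgM; first exact: cvg_cst.
  apply: cvgB; apply: cvgM; [exact: cvg_cst|exact: cvg_fst|exact: cvg_cst|].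
  exact: cvg_snd.
- move=> w w01; split=> /=.
    by rewrite normr_ge0/= ler_norml /u; apply/andP; split; nra.
  have [u0|u0] := leP 0 (u w).
    by exists z => //; rewrite ger0_norm//; field.
  by exists x => //; rewrite ltr0_norm//; field.
- have zx : z - x != 0 by rewrite subr_eq0; apply/eqP => /esym.
  by move=> w _; rewrite /u /=; field; rewrite zx lt0r_neq0.
- rewrite y1E /u mulr0 addr0 normrN ger0_norm; last lra.
  by congr pair; field.
- have -> : u 1 = t by rewrite /u; ring.
  rewrite y2E ger0_norm; last lra.
  by congr pair; field.
Qed.

(** * The fan is the perfect cone *)

Lemma cone_pi_vertex_eq (R : realType) (T : topologicalType)
    (p q : T * unit_itv R) :
  set_val p.2 = 0 -> set_val q.2 = 0 -> cone_pi p = cone_pi q.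
Proof.
move=> p0 q0; apply/eqmodP/predU1P; right.
by apply/andP; split; apply/eqP/set_val_inj.
Qed.

Section fan_cone.
Context (R : realType) (X : set R) (X1 : forall x, X x -> `|x| <= 1).

Let pcone := perfect_cone R (set_type X).
Let proj := @cone_pi R (set_type X).
Let vertex := @cone_vertex R (set_type X).

Lemma fan_ptP (p : set_type X * unit_itv R) :
  fan X (set_val p.1 * set_val p.2, set_val p.2).
Proof.
by split; [exact: unit_itvP|exists (set_val p.1) => //; exact: set_valP].
Qed.

Definition fan_pt (p : set_type X * unit_itv R) : set_type (fan X) :=
  set_elt (fan_ptP p).

Lemma fan_ptE p : set_val (fan_pt p) = (set_val p.1 * set_val p.2, set_val p.2).
Proof. by []. Qed.

Definition fan_of_cone (c : pcone) : set_type (fan X) :=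
  fan_pt (repr (c : cone R (set_type X))).

(** The whole bottom of the cylinder goes to the origin, so the value does not
    depend on the representative. *)
Lemma fan_of_cone_pi p : fan_of_cone (cone_pi p) = fan_pt p.
Proof.
apply: set_val_inj; rewrite /fan_of_cone !fan_ptE.
have /cone_pi_eq : cone_pi (repr (cone_pi p)) = cone_pi p by exact: reprK.
by case=> [->//|[-> ->]]; rewrite !mulr0.
Qed.

Lemma fan_pt_continuous : continuous fan_pt.
Proof.
have c2 : continuous (fun p : set_type X * unit_itv R => set_val p.2 : R).
  move=> p; apply: (@continuous_comp _ _ _ snd (set_val : unit_itv R -> R)).
    exact: cvg_snd.
  exact: set_val_continuous.
move=> p; apply: cvg_set_type; apply: continuous_at_pair; last exact: c2.
apply: cvgM; last exact: c2.
apply: (@continuous_comp _ _ _ fst (set_val : set_type X -> R)).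
  exact: cvg_fst.
exact: set_val_continuous.
Qed.

(** Near the vertex, continuity rests on the bound on [X]: a point of height t
    and slope x has abscissa x * t, of absolute value at most t. *)
Lemma fan_of_cone_continuous : continuous fan_of_cone.
Proof.
apply/continuousP => A oA; split.
  rewrite cone_openE.
  have -> : proj @^-1` (fan_of_cone @^-1` A `\` vertex) =
      fan_pt @^-1` A `&` proj @^-1` (~` vertex).
    by apply/seteqP; split=> p /=; rewrite fan_of_cone_pi.
  apply: openI; last exact: cone_vertexC_open.
  by move/continuousP: fan_pt_continuous; exact.
move=> [c [/= Ap [p /= p0 pE]]]; move: Ap; rewrite -pE fan_of_cone_pi => Ap.
have [B oB BA] := oA; move: Ap; rewrite -BA => /=.
rewrite -/(set_val (fan_pt p)) fan_ptE p0 mulr0 => B0.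
have /nbhs_ballP[e /= e0 eB] := open_nbhs_nbhs (conj oB B0).
exists e => // _ [q /= qe <-] /=; rewrite fan_of_cone_pi; apply: eB.
have /andP[q0 _] := unit_itvP q.2.
have qle : `|set_val q.1 * set_val q.2| <= set_val q.2.
  by rewrite normrM (ger0_norm q0) ler_piMl// X1//; exact: set_valP.
split; rewrite /ball/= sub0r normrN; first exact: le_lt_trans qle qe.
by rewrite ger0_norm.
Qed.

Lemma fan_slopeP (y : set_type (fan X)) :
  exists x : set_type X, (set_val y).1 = set_val x * (set_val y).2.
Proof. by have [_ [x Xx yE]] := set_valP y; exists (set_elt Xx). Qed.

(** At the origin this is an arbitrary element of [X]. *)
Definition fan_slope y : set_type X := projT1 (cid (fan_slopeP y)).

Lemma fan_slopeE y : (set_val y).1 = set_val (fan_slope y) * (set_val y).2.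
Proof. exact: projT2 (cid (fan_slopeP y)). Qed.

Lemma fan_level_itv (y : set_type (fan X)) : [set` `[0, 1]] (set_val y).2.
Proof. by have [t01 _] := set_valP y; rewrite /= in_itv. Qed.

Definition fan_level y : unit_itv R := set_elt (fan_level_itv y).

Definition cone_of_fan y : pcone := cone_pi (fan_slope y, fan_level y).

Lemma fst_set_val_continuous :
  continuous (fun y : set_type (fan X) => (set_val y).1).
Proof.
move=> y; apply: (continuous_comp (@set_val_continuous _ _ y)).
exact: continuous_fst.
Qed.

Lemma snd_set_val_continuous :
  continuous (fun y : set_type (fan X) => (set_val y).2).
Proof.
move=> y; apply: (continuous_comp (@set_val_continuous _ _ y)).
exact: continuous_snd.
Qed.

Lemma fan_slope_continuous y : (set_val y).2 != 0 ->
  {for y, continuous fan_slope}.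
Proof.
move=> y0.
suff slope_cvg : set_val (fan_slope y') @[y' --> y] --> set_val (fan_slope y).
  exact: (@cvg_set_type _ _ _ fan_slope).
have : (set_val y').1 / (set_val y').2 @[y' --> y] -->
    (set_val y).1 / (set_val y).2.
  exact: (cvgM (@fst_set_val_continuous y)
    (cvgV y0 (@snd_set_val_continuous y))).
rewrite fan_slopeE mulfK//.
move=> ratio_cvg; apply: cvg_trans ratio_cvg.
apply: (@near_eq_cvg _ _ (nbhs y) (nbhs_filter y)).
near=> y'; rewrite fan_slopeE mulfK//; near: y'.
exact: (cvgr_neq0 _ (@snd_set_val_continuous y)).
Unshelve. all: by end_near. Qed.

(** At the origin only the height matters, because the perfect cone has the
    sets of points of height less than e as a base of neighborhoods of its
    vertex; the slope need not have a limit there. *)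
Lemma cone_of_fan_continuous : continuous cone_of_fan.
Proof.
apply/continuousP => U [oU vU]; rewrite openE => y /= Uy; rewrite /interior.
have [y0|y0] := eqVneq (set_val y).2 0.
  have [|e e0 eU] := vU.
    by exists (cone_of_fan y); split=> //; exact/cone_pi_vertex.
  have : \forall y' \near y, (set_val y').2 < e.
    by apply: (cvgr_lt _ (@snd_set_val_continuous y)); rewrite y0.
  by apply: filterS => y' y'e; apply: eU; exists (fan_slope y', fan_level y').
have cpair : {for y, continuous (fun y => (fan_slope y, fan_level y))}.
  apply: continuous_at_pair; first exact: fan_slope_continuous.
  by apply: cvg_set_type; exact: snd_set_val_continuous.
move: oU; rewrite cone_openE => oU.
have : nbhs y ((fun y => (fan_slope y, fan_level y)) @^-1`
    (proj @^-1` (U `\` vertex))).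
  apply: cpair; apply: open_nbhs_nbhs; split=> //; split=> //.
  by move/cone_pi_vertex/eqP => /=; exact/negP.
by apply: filterS => y' [].
Qed.

Lemma cone_of_fanK : cancel cone_of_fan fan_of_cone.
Proof.
move=> y; rewrite /cone_of_fan fan_of_cone_pi; apply: set_val_inj.
rewrite fan_ptE.
have -> : set_val (fan_level y) = (set_val y).2 by [].
by rewrite -fan_slopeE -surjective_pairing.
Qed.

Lemma fan_of_coneK : cancel fan_of_cone cone_of_fan.
Proof.
move=> c; have [p ->] : exists p, c = cone_pi p.
  by exists (repr (c : cone R (set_type X))); exact/esym/reprK.
rewrite fan_of_cone_pi /cone_of_fan.
have lvl : fan_level (fan_pt p) = p.2 by exact: val_inj.
have := fan_slopeE (fan_pt p); rewrite lvl fan_ptE /=.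
have [p0 _|p0 /(mulIf p0)/set_val_inj <-] := eqVneq (set_val p.2) 0.
  by apply: cone_pi_vertex_eq => //; rewrite lvl.
by rewrite -surjective_pairing.
Qed.

Lemma fan_homeomorphic :
  homeomorphic (set_type (fan X)) (perfect_cone R (set_type X)).
Proof.
exists cone_of_fan; split; first exact: cone_of_fan_continuous.
exists fan_of_cone; split; [exact: fan_of_cone_continuous|exact: cone_of_fanK|].
exact: fan_of_coneK.
Qed.

End fan_cone.

(** * The fan over a G_delta set is a G_delta set *)

(** The set of slopes is the intersection of open sets [U i], but the slope is
    not continuous at the origin.  So the n-th open set constrains the slope,
    by [U i] for i <= n, only at heights at least 1 / (n + 1); every positive
    height is eventually above this threshold.  The other three conditions cut
    out in the limit the closed triangle |a| <= t <= 1, whose only point of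
    height 0 is the origin. *)
Lemma fan_Gdelta (R : realType) (X : set R) :
  X !=set0 -> (forall x, X x -> `|x| <= 1) -> Gdelta X -> Gdelta (fan X).
Proof.
move=> [x0 Xx0] X1 [U oU XU].
pose e n : R := n.+1%:R^-1.
have e_gt0 n : 0 < e n by rewrite invr_gt0.
have e_small (a b : R) : (forall n, a < b + e n) -> a <= b.
  move=> ab; rewrite leNgt; apply/negP => /ltr_add_invr[n].
  by move=> /lt_trans/(_ (ab n)); rewrite ltxx.
pose V n : set R := \bigcap_(i in `I_n.+1) U i.
have oV n : open (V n).
  rewrite /V bigcap_mkord; elim/big_ind : _ => //; first exact: openT.
  exact: openI.
pose W n : set (R * R) :=
  [set p | - p.2 < e n] `&` [set p | p.2 < 1 + e n] `&`
  [set p | `|p.1| < p.2 + e n] `&`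
  ([set p | p.2 < e n] `|` [set p | 0 < p.2 /\ V n (p.1 / p.2)]).
have c1 : continuous (fun p : R * R => p.1) by exact: continuous_fst.
have c2 : continuous (fun p : R * R => p.2) by exact: continuous_snd.
have cc a : continuous (fun p : R * R => a : R) by move=> p; exact: cvg_cst.
exists W => [n|].
  apply: openI; [apply: openI; [apply: openI|]|apply: openU];
    try apply: open_lt_fun => //.
  - by move=> p; apply: cvgN; exact: c2.
  - by move=> p; exact: (cvg_norm (c1 p)).
  - by move=> p; apply: cvgD; [exact: c2|exact: cc].
  rewrite openE => p [/= p2 Vp]; rewrite /interior.
  have near_pos : \forall p' \near p, 0 < p'.2 by apply: (cvgr_gt _ (c2 p)).
  have near_V : \forall p' \near p, V n (p'.1 / p'.2).
    have p20 : p.2 != 0 by rewrite gt_eqF.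
    have := cvgM (c1 p) (cvgV p20 (c2 p)); apply.
    exact: open_nbhs_nbhs.
  by apply: filterS2 near_pos near_V.
apply/seteqP; split=> [[a t] [/= /andP[t0 t1] [x Xx ->]] n _|[a t] Wat].
  split; [split; [split|]|] => /=.
  - by apply: le_lt_trans (e_gt0 n); rewrite oppr_le0.
  - by rewrite ltr_pwDr.
  - rewrite ltr_pwDr// normrM (ger0_norm t0) ler_piMl// X1//.
  - have [->|tn0] := eqVneq t 0; first by left.
    right; split; first by rewrite lt_def tn0.
    by rewrite mulfK// => i _; move: Xx; rewrite XU; apply.
have t0 : 0 <= t.
  rewrite -oppr_le0; apply: e_small => n; rewrite add0r.
  by have [[[]]] := Wat n I.
have t1 : t <= 1 by apply: e_small => n; have [[[]]] := Wat n I.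
have at_ : `|a| <= t by apply: e_small => n; have [[]] := Wat n I.
split; first exact/andP.
have [tE|tn0] := eqVneq t 0.
  by exists x0 => //=; move: at_; rewrite tE normr_le0 mulr0 => /eqP.
have {tn0} t_gt0 : 0 < t by rewrite lt_def tn0.
exists (a / t); last by rewrite /= divfK// gt_eqF.
rewrite XU => k _; have [m] := ltr_add_invr t_gt0; rewrite add0r => mt.
have [_ [/=|[_ /(_ k)]]] := Wat (maxn k m) I; last first.
  by apply; rewrite /= ltnS leq_maxl.
(* Here t would be below the threshold. *)
move=> t_lt; exfalso; have : e (maxn k m) <= e m.
  by rewrite /e lef_pV2 ?posrE// ler_nat ltnS leq_maxr.
move=> /(lt_le_trans t_lt)/lt_trans/(_ mt).
by rewrite ltxx.
Qed.

(** * The fan over the irrationals is not a B_1-retract *)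

Definition unit_irrational (R : realType) : set R :=
  [set x | 0 < x < 1] `&` @irrational R.

(** A connected part of the fan that avoids the origin cannot jump over a
    rational slope. *)
Lemma fan_irrational_not_B1_retract (R : realType) :
  ~ B1_retract (fan (@unit_irrational R)).
Proof.
move=> [r_ [r [cr rlim rid]]].
have section_continuous : continuous (fun x : R => (x, 1 : R)).
  by move=> x; apply: continuous_at_pair; [exact: cvg_id|exact: cvg_cst].
pose P n (x : R) : R * R := set_val (r_ n (x, 1)).
have cP n : continuous (P n).
  move=> x; apply: (@continuous_comp _ _ _ (fun x : R => r_ n (x, 1)) set_val).
    apply: (@continuous_comp _ _ _ (fun x : R => (x, 1 : R)) (r_ n)).
      exact: section_continuous.
    exact: cr.
  exact: set_val_continuous.
have ca n : continuous (fun x => (P n x).1).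
  move=> x; apply: (@continuous_comp _ _ _ (P n) fst); first exact: cP.
  exact: continuous_fst.
have ch n : continuous (fun x => (P n x).2).
  move=> x; apply: (@continuous_comp _ _ _ (P n) snd); first exact: cP.
  exact: continuous_snd.
have P_cvg x : unit_irrational x -> P n x @[n --> \oo] --> (x, 1 : R).
  move=> Xx; have Ex : fan (@unit_irrational R) (x, 1).
    by split=> /=; [rewrite ler01 lexx|exists x; rewrite ?mulr1].
  have := rlim (set_val (set_elt Ex)); rewrite rid => rx.
  exact: (cvg_comp _ _ rx (@set_val_continuous _ _ (set_elt Ex))).
have a_cvg x (Xx : unit_irrational x) : (P n x).1 @[n --> \oo] --> x.
  exact: (cvg_comp _ _ (P_cvg x Xx) (@continuous_fst _ _ (x, 1 : R))).
have h_cvg x (Xx : unit_irrational x) : (P n x).2 @[n --> \oo] --> (1 : R).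
  exact: (cvg_comp _ _ (P_cvg x Xx) (@continuous_snd _ _ (x, 1 : R))).
(* Off the open set D N lie the x of [0, 1] at which the height of r_n(x, 1)
   is at least 1/2 for all n >= N. *)
pose D N : set R := [set x | x < 0] `|` [set x | 1 < x] `|`
  \bigcup_(n in [set n | (N <= n)%N]) [set x | (P n x).2 < 1 / 2].
have oD N : open (D N).
  apply: openU; first by apply: openU; [exact: open_lt|exact: open_gt].
  apply: bigcup_open => n _; apply: open_lt_fun; first exact: ch.
  by move=> x; exact: cvg_cst.
have [N notdense] : exists N, ~ dense (D N).
  (* If every D N is dense, so is their intersection with the irrationals,
     and it meets ]0, 1[; but for x in X the heights tend to 1. *)
  apply: contrapT => /forallNP Ddense.
  have [B oB irrB] := @irrational_Gdelta R.
  have DB i : open (D i `&` B i) /\ dense (D i `&` B i).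
    have [oBi dBi] := oB i; split; first exact: openI.
    by apply: denseI => //; apply: contrapT; exact: Ddense.
  have [||x [x01 xDB]] := Baire DB (O := `]0, 1[%classic).
  - by exists (1 / 2); rewrite /= in_itv/=; apply/andP; split; lra.
  - exact: itv_open.
  have Xx : unit_irrational x.
    split; first by move: x01; rewrite /= in_itv.
    by rewrite irrB => i _; have [] := xDB i I.
  have half1 : 1 / 2 < 1 :> R by lra.
  have [N _ hN] := cvgr_gt _ (h_cvg x Xx) _ half1.
  have [/andP[x_gt0 x_lt1] _] := Xx.
  have [[[/= x_lt0|/= x_gt1]|[n /= Nn hn]] _] := xDB N I.
  - by have := lt_trans x_lt0 x_gt0; rewrite ltxx.
  - by have := lt_trans x_lt1 x_gt1; rewrite ltxx.
  - by have := lt_trans hn (hN n Nn); rewrite ltxx.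
(* Some interval avoids D N. *)
have [O [[x0 [oO Ox0]] OD]] := denseNE notdense.
have /nbhs_ballP[e /= e0 eO] := open_nbhs_nbhs (conj oO Ox0).
have [|q] := @rat_in_itvoo R (x0 - e) (x0 + e); first lra.
rewrite in_itv/= => /andP[q1 q2].
have [c ic /andP[c1 cq]] := irrational_in_itvoo q1.
have [d id /andP[qd d1]] := irrational_in_itvoo q2.
have itvD x : c <= x <= d -> ~ D N x.
  move=> /andP[cx xd] Dx.
  suff : (O `&` D N) x by rewrite OD.
  by split=> //; apply: eO; rewrite /ball/= ltr_distlC; apply/andP; split; lra.
have itvX x : c <= x <= d -> irrational x -> unit_irrational x.
  move=> /itvD Dx ix; split=> //=; apply/andP; split.
  - rewrite lt_def; apply/andP; split.
      by apply/eqP => x0E; apply: ix; exists 0; rewrite // x0E rmorph0.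
    by rewrite leNgt; apply/negP => x_lt0; apply: Dx; left; left.
  - rewrite lt_def; apply/andP; split.
      by apply/eqP => x1E; apply: ix; exists 1; rewrite // -x1E rmorph1.
    by rewrite leNgt; apply/negP => x_gt1; apply: Dx; left; right.
have Xc : unit_irrational c by apply: itvX => //; apply/andP; split; lra.
have Xd : unit_irrational d by apply: itvX => //; apply/andP; split; lra.
(* At positive height the sign of phi compares the slope with q. *)
pose phi n x := (P n x).1 - ratr q * (P n x).2.
have cphi n : continuous (phi n).
  move=> x; apply: cvgB; first exact: ca.
  by apply: cvgM; [exact: cvg_cst|exact: ch].
have phi_cvg x : unit_irrational x -> phi n x @[n --> \oo] --> x - ratr q.
  move=> Xx; rewrite -[X in _ - X]mulr1; apply: cvgB; first exact: a_cvg.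
  by apply: cvgM; [exact: cvg_cst|exact: h_cvg].
have [n [Nn phic phid]] : exists n, [/\ (N <= n)%N, phi n c < 0 & 0 < phi n d].
  have [|N1 _ phic] := cvgr_lt _ (phi_cvg c Xc) 0; first by rewrite subr_lt0.
  have [|N2 _ phid] := cvgr_gt _ (phi_cvg d Xd) 0; first by rewrite subr_gt0.
  exists (maxn N (maxn N1 N2)); rewrite leq_maxl; split=> //.
    by apply: phic; rewrite /= !leq_max leqnn orbT.
  by apply: phid; rewrite /= !leq_max leqnn !orbT.
have [||z zcd phiz] := @IVT R (phi n) c d 0 _ (continuous_subspaceT (cphi n)).
- lra.
- by rewrite ge_min le_max (ltW phic) (ltW phid) orbT.
move: zcd; rewrite in_itv/= => /itvD Dz.
have hz : 1 / 2 <= (P n z).2.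
  by rewrite leNgt; apply/negP => hz; apply: Dz; right; exists n.
have [x [_ ix] [t _ Pz]] := fan_polar (r_ n (z, 1)).
have {}Pz : P n z = (x * t, t) by [].
move: hz phiz; rewrite /phi Pz /= -mulrBl => ht /eqP.
rewrite mulf_eq0 => /orP[|/eqP t0]; last by move: ht; rewrite t0; lra.
by rewrite subr_eq0 => /eqP xq; apply: ix; exists q.
Qed.

Theorem mainTheorem2 (R : realType) :
  exists (X : set R) (E : set (R * R)),
    [/\ ind_zero (set_type X),
        metrizable R (set_type X) &
        separable (set_type X)] /\
    [/\ arcwise_connected R (set_type E),
        Gdelta E,
        homeomorphic (set_type E) (perfect_cone R (set_type X)) &
        ~ B1_retract E].
Proof.
pose X := @unit_irrational R.
have X0 : X !=set0.
  have [c ic c01] := irrational_in_itvoo (@ltr01 R).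
  by exists c.
have X1 x : X x -> `|x| <= 1.
  by move=> [/andP[x0 x1] _]; rewrite gtr0_norm// ltW.
have GX : Gdelta X.
  have [B oB irrB] := @irrational_Gdelta R.
  exists (fun n => `]0, 1[%classic `&` B n) => [n|].
    by apply: openI; [exact: itv_open|have [] := oB n].
  rewrite bigcapIr// -irrB.
  by apply/seteqP; split=> x [x01 ix]; split=> //; move: x01; rewrite /= in_itv.
exists X, (fan X); split; split.
- by apply: ind_zero_irrational => // x [].
- exact: metrizable_set_type.
- exact: separable_set_type.
- exact: fan_arcwise_connected.
- exact: fan_Gdelta.
- exact: fan_homeomorphic.
- exact: fan_irrational_not_B1_retract.
Qed.
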